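(* Let $G$ be a Garside group, $q\in\mathbb{Z}$ and $x,u,v\in G$. If $x^u\in G_q$ and $x^v\in G_q$, then $x^{u\wedge v}\in G_q$. In particular, $\mathrm{c}_q(G_p)\subset G_p$ for all $p,q\in\mathbb{Z}$.
   Context: Garside groups. A monoid $M$ is atomic if it is generated by its atoms (elements $x\ne1$ such that $x=yz$ implies $y=1$ or $z=1$) and every $x\in M$ has a finite norm $\|x\|$, the maximal number of factors in an expression of $x$ as a product of atoms. A Garside monoid is a cancellative atomic monoid $M$ in which any two elements have left and right greatest common divisors and left and right least common multiples, together with a Garside element $\Delta\in M$: its left divisors coincide with its right divisors, and they form a finite set $S$ (the simple elements) generating $M$. A Garside group $G$ is the group of fractions of a Garside monoid $M$. For $x,y\in G$, $x\prec y$ means $x^{-1}y\in M$ (a partial order on $G$), and $x\wedge y$, $x\vee y$ are the greatest lower bound and least upper bound with respect to $\prec$. Write $x^u=u^{-1}xu$. For $q\in\mathbb{Z}$ the cycling operation of order $q$ is $\mathrm{c}_q(x)=x^{x\wedge\Delta^q}$, and $G_q=\{x\in G\mid \mathrm{c}_q^N(x)=x\text{ for some }N>0\}$. *)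

(* Defs.v *)
From HB Require Import structures.
From mathcomp Require Import all_boot ssrint.
From mathcomp Require Import boolp classical_sets functions cardinality.

Set Implicit Arguments.
Unset Strict Implicit.
Unset Printing Implicit Defensive.

Local Open Scope classical_set_scope.
Local Open Scope group_scope.

Section GarsideMonoid.
Variable M : monoidType.
Implicit Types a b c d x y z : M.

Definition ldvd a b := exists c, b = a * c.
Definition rdvd a b := exists c, b = c * a.

Definition is_gcd (dvd : M -> M -> Prop) a b d :=
  [/\ dvd d a, dvd d b & forall c, dvd c a -> dvd c b -> dvd c d].

Definition is_lcm (dvd : M -> M -> Prop) a b m :=
  [/\ dvd a m, dvd b m & forall c, dvd a c -> dvd b c -> dvd m c].

Definition atom x := x <> 1 /\ forall y z, x = y * z -> y = 1 \/ z = 1.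

Definition factorization (A : set M) (s : seq M) x :=
  {in s, forall a, A a} /\ \prod_(a <- s) a = x.

Definition generates (A : set M) := forall x, exists s, factorization A s x.

Definition is_norm x n :=
  (exists2 s, factorization atom s x & size s = n) /\
  (forall s, factorization atom s x -> size s <= n).

Definition atomic := generates atom /\ forall x, exists n, is_norm x n.

Definition cancellative := @left_injective M M M *%g /\ @right_injective M M M *%g.

Record garside_element (Delta : M) : Prop := GarsideElement {
  garside_divs : ldvd^~ Delta = rdvd^~ Delta;
  garside_fin : finite_set (ldvd^~ Delta);
  garside_gen : generates (ldvd^~ Delta) }.

Record garside_monoid (Delta : M) : Prop := GarsideMonoid {
  garside_cancel : cancellative;
  garside_atomic : atomic;
  garside_lgcd : forall a b, exists d, is_gcd ldvd a b d;
  garside_rgcd : forall a b, exists d, is_gcd rdvd a b d;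
  garside_llcm : forall a b, exists m, is_lcm ldvd a b m;
  garside_rlcm : forall a b, exists m, is_lcm rdvd a b m;
  garside_elt : garside_element Delta }.

End GarsideMonoid.

Definition group_of_fractions (M : monoidType) (G : groupType)
    (iota : UMagmaMorphism.type M G) :=
  injective iota /\ forall x : G, exists a b, x = (iota a)^-1 * iota b.

Definition expgz (G : groupType) (x : G) (q : int) : G :=
  match q with Posz n => x ^+ n | Negz n => x ^- n.+1 end.

Section GarsideGroup.
Variables (M : monoidType) (G : groupType).
Variable iota : UMagmaMorphism.type M G.
Implicit Types x y z w : G.

Definition prec x y := range iota (x^-1 * y).

Definition is_meet x y w :=
  [/\ prec w x, prec w y & forall z, prec z x -> prec z y -> prec z w].

(* In a Garside group the greatest lower bound exists and is unique
   (lemmas [meetP] and [meet_unique] below), so the default value 1 is never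
   used. *)
Definition meet x y : G := xget 1 [set w | is_meet x y w].

Definition cycling (Delta : M) (q : int) x : G :=
  x ^ meet x (expgz (iota Delta) q).

Definition cycling_periodic (Delta : M) (q : int) : set G :=
  [set x | exists2 N, 0 < N & iter N (cycling Delta q) x = x].

End GarsideGroup.

Section MeetFacts.
Variables (M : monoidType) (Delta : M) (G : groupType).
Variable iota : UMagmaMorphism.type M G.
Hypotheses (hM : garside_monoid Delta) (hG : group_of_fractions iota).

Lemma atomic_conical (a b : M) : a * b = 1 -> a = 1.
Proof.
move=> ab1; have [gen norm] := garside_atomic hM.
have [sa [saP saE]] := gen a; have [sb [sbP sbE]] := gen b.
have P k : factorization (@atom M) (flatten (nseq k (sa ++ sb))) 1.
  split=> [c /flattenP[t]|].
    by rewrite mem_nseq => /andP[_ /eqP->]; rewrite mem_cat => /orP[/saP|/sbP].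
  elim: k => [|k IH]; first by rewrite big_nil.
  by rewrite /= !big_cat /= saE sbE IH ab1 mulg1.
have [n [_ /(_ _ (P n.+1))]] := norm 1.
rewrite size_flatten /shape map_nseq sumn_nseq size_cat.
case: (sa) saE => [|c s _]; first by rewrite big_nil.
by move=> /(leq_trans (leq_pmull n.+1 _)) => /(_ isT); rewrite ltnn.
Qed.

Lemma prec_trans x y z : prec iota x y -> prec iota y z -> prec iota x z.
Proof.
move=> [a _ aE] [b _ bE]; exists (a * b) => //.
by rewrite gmulfM aE bE mulgA mulgK.
Qed.

Lemma prec_anti x y : prec iota x y -> prec iota y x -> x = y.
Proof.
move=> [a _ aE] [b _ bE].
have ab : a * b = 1.
  by apply: hG.1; rewrite gmulfM aE bE gmulf1 mulgA mulgK mulVg.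
move: aE; rewrite (atomic_conical ab) gmulf1 => e.
by rewrite -[RHS](mulVKg x) -e mulg1.
Qed.

Lemma prec_mul2l z x y : prec iota (z * x) (z * y) <-> prec iota x y.
Proof. by rewrite /prec invgM -mulgA mulKg. Qed.

Lemma prec_iota a b : prec iota (iota a) (iota b) <-> ldvd a b.
Proof.
split=> [[c _ cE]|[c ->]]; last by exists c => //; rewrite gmulfM mulKg.
by exists c; apply: hG.1; rewrite gmulfM cE mulVKg.
Qed.

Lemma common_denominator x y :
  exists m a b, iota m * x = iota a /\ iota m * y = iota b.
Proof.
have [a [b ->]] := hG.2 x; have [c [d ->]] := hG.2 y.
have [m [[e mE] [f mE'] _]] := garside_rlcm hM a c.
exists m, (e * b), (f * d); split.
  by rewrite mE !gmulfM -!mulgA mulVKg.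
by rewrite mE' !gmulfM -!mulgA mulVKg.
Qed.

Lemma meet_exists x y : exists w, is_meet iota x y w.
Proof.
have [m [a [b [xE yE]]]] := common_denominator x y.
have [d [da db dmax]] := garside_lgcd hM a b.
exists ((iota m)^-1 * iota d); split.
- by apply/(prec_mul2l (iota m)); rewrite mulVKg xE; apply/prec_iota.
- by apply/(prec_mul2l (iota m)); rewrite mulVKg yE; apply/prec_iota.
move=> z zx zy; apply/(prec_mul2l (iota m)); rewrite mulVKg.
have [n [c [_ [cE _]]]] := common_denominator (iota m * z) 1.
have zle t e : iota m * t = iota e -> prec iota z t -> ldvd c (n * e).
  move=> tE zt; apply/prec_iota; rewrite -cE gmulfM -tE.
  by do 2!apply/prec_mul2l.
have [g [[g1 g1E] [g2 g2E] gmax]] := garside_lgcd hM (n * a) (n * b).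
have [h gE] : ldvd n g by apply: gmax; [exists a | exists b].
have [_ rcan] := garside_cancel hM.
have hd : ldvd h d.
  apply: dmax; [exists g1 | exists g2]; apply: (rcan n).
    by rewrite g1E gE mulgA.
  by rewrite g2E gE mulgA.
apply/(prec_mul2l (iota n)); rewrite cE -gmulfM; apply/prec_iota.
have [k ->] := hd; have [l gE'] := gmax _ (zle _ _ xE zx) (zle _ _ yE zy).
by exists (l * k); rewrite mulgA -gE gE' mulgA.
Qed.

Lemma meetP x y : is_meet iota x y (meet iota x y).
Proof. exact: xgetPex (meet_exists x y). Qed.

Lemma meet_unique x y w : is_meet iota x y w -> meet iota x y = w.
Proof.
move=> [wx wy wmax]; have [mx my mmax] := meetP x y.
by apply: prec_anti; [apply: wmax | apply: mmax].
Qed.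

End MeetFacts.

(* Main.v *)
(** Cycling acts on conjugators.  For $x, u \in G$ put
    $T_x(u) = (x \wedge \Delta^q)^{-1} (xu \wedge u\Delta^q)$; then
    $c_q(x^u) = c_q(x)^{T_x(u)}$, and $T_x$ fixes 1, commutes with right
    multiplication by $\Delta$ and preserves meets.  After conjugation one may
    assume $u = 1$.  If $N$ is a common period of $x$ and $y = x^v$, the
    composite $F$ of the $N$ successive maps $T$ along the orbit of $x$ acts
    injectively on the conjugators from $x$ to $y$, and stabilises each interval
    $[\Delta^{-k}, \Delta^k]$, which is finite.  Hence $v$ is periodic under $F$,
    so is $1 \wedge v$, and therefore $x^{1 \wedge v}$ is periodic under $c_q$.
    The second claim is the case $u = x$, $v = \Delta^q$. *)
Require Import Defs.
From mathcomp Require Import all_boot ssrint.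
From mathcomp Require Import boolp classical_sets.
From mathcomp Require Import cardinality.
Local Open Scope classical_set_scope.
Local Open Scope group_scope.

(** * Periodic points of self-maps of finite sets *)

(** If two iterates of [v] agree, injectivity on [A] cancels the smaller exponent and [v] recurs;
    otherwise the iterates embed the naturals into [A]. *)
Lemma finite_orbit_periodic (T : Type) (f : T -> T) (A : set T) (v : T) :
  finite_set A -> (forall w, A w -> A (f w)) ->
  (forall w w', A w -> A w' -> f w = f w' -> w = w') -> A v ->
  exists2 n, 0 < n & iter n f v = v.
Proof.
move=> Afin fA f_inj Av; apply: contrapT => nper.
have iterA i w : A w -> A (iter i f w) by move=> Aw; elim: i => //= i; apply: fA.
have iter_inj i w w' : A w -> A w' -> iter i f w = iter i f w' -> w = w'.
  move=> Aw Aw'; elim: i => //= i IH /f_inj e.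
  by apply/IH/e; apply: iterA.
have lt_iter i j : (i < j)%N -> iter i f v <> iter j f v.
  move=> ij; rewrite -(subnKC (ltnW ij)) iterD => /iter_inj e.
  apply: nper; exists (j - i)%N; rewrite ?subn_gt0 //.
  by rewrite -e //; apply: iterA.
apply: infinite_nat.
suff : finite_set ((fun i => iter i f v) @^-1` A).
  by apply: sub_finite_set => i _; apply: iterA.
apply: finite_preimage => // i j _ _ e.
by have [/lt_iter|/lt_iter/nesym|] := ltngtP i j.
Qed.

Lemma commute_expgz (G : groupType) (x : G) (q : int) (y : G) :
  commute y x -> commute y (expgz x q).
Proof. by case: q => n yx; [|apply: commuteV]; apply: commuteX. Qed.

Section GarsideGroup.
Variables (M : monoidType) (Delta : M) (G : groupType).
Variable iota : UMagmaMorphism.type M G.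
Hypotheses (hM : garside_monoid Delta) (hG : group_of_fractions iota).

Local Notation "x ≺ y" := (prec iota x y) (at level 70).
Local Notation "x ∧ y" := (meet iota x y) (at level 45, left associativity).
Local Notation D := (iota Delta).

Let trans {x y z} : x ≺ y -> y ≺ z -> x ≺ z := @prec_trans M G iota x y z.
Let anti {x y} : x ≺ y -> y ≺ x -> x = y := @prec_anti M Delta G iota hM hG x y.

(** * Meets and their compatibility with translations *)

Lemma prec_refl x : x ≺ x.
Proof. by exists 1 => //; rewrite gmulf1 mulVg. Qed.

Lemma meet_precl x y : x ∧ y ≺ x. Proof. by case: (meetP hM hG x y). Qed.
Lemma meet_precr x y : x ∧ y ≺ y. Proof. by case: (meetP hM hG x y). Qed.
Lemma prec_meet w x y : w ≺ x -> w ≺ y -> w ≺ x ∧ y.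
Proof. by case: (meetP hM hG x y) => _ _; apply. Qed.

Lemma meet_idPl {x y} : x ∧ y = x <-> x ≺ y.
Proof.
split=> [<-|xy]; first exact: meet_precr.
by apply: anti (meet_precl _ _) _; apply: prec_meet => //; apply: prec_refl.
Qed.

Lemma meetACA : interchange (meet iota) (meet iota).
Proof.
have half a b c d : (a ∧ b) ∧ (c ∧ d) ≺ (a ∧ c) ∧ (b ∧ d).
  apply: prec_meet; apply: prec_meet;
    [apply: trans (meet_precl _ _) (meet_precl _ _)
    |apply: trans (meet_precr _ _) (meet_precl _ _)
    |apply: trans (meet_precl _ _) (meet_precr _ _)
    |apply: trans (meet_precr _ _) (meet_precr _ _)].
by move=> a b c d; apply: anti.
Qed.

Lemma meetMl z x y : z * (x ∧ y) = (z * x) ∧ (z * y).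
Proof.
apply: anti.
  by apply: prec_meet; apply/prec_mul2l; [apply: meet_precl | apply: meet_precr].
apply/(prec_mul2l iota z^-1); rewrite mulKg.
by apply: prec_meet; apply/(prec_mul2l iota z); rewrite mulVKg;
   [apply: meet_precl | apply: meet_precr].
Qed.

(* Equivalently, $z$ normalises $M$. *)
Definition right_order_auto z := forall u v, u * z ≺ v * z <-> u ≺ v.

Lemma right_order_autoM z t :
  right_order_auto z -> right_order_auto t -> right_order_auto (z * t).
Proof. by move=> hz ht u v; rewrite !mulgA ht. Qed.

Lemma right_order_autoV z : right_order_auto z -> right_order_auto z^-1.
Proof. by move=> hz u v; rewrite -hz !mulgVK. Qed.

Lemma right_order_autoX z n : right_order_auto z -> right_order_auto (z ^+ n).
Proof.
move=> hz; elim: n => [|n IH]; first by move=> u v; rewrite expg0 !mulg1.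
by rewrite expgS; apply: right_order_autoM.
Qed.

Lemma meetMr z x y : right_order_auto z -> (x ∧ y) * z = (x * z) ∧ (y * z).
Proof.
move=> hz; apply: anti.
  by apply: prec_meet; apply/hz; [apply: meet_precl | apply: meet_precr].
apply/(right_order_autoV _ hz); rewrite mulgK.
by apply: prec_meet; apply/hz; rewrite mulgVK;
   [apply: meet_precl | apply: meet_precr].
Qed.

(** * Powers of [Delta] as order automorphisms *)

(** For a simple [a], write [Delta = a * t]. Then [t] is simple, so [Delta = t * r] and
    [a * Delta = Delta * r]; the other side is symmetric. Products of simple elements follow by
    induction. *)
Lemma Delta_normal (m : M) :
  (exists m', m * Delta = Delta * m') /\ (exists m', Delta * m = m' * Delta).
Proof.
have dE (s : M) : ldvd s Delta <-> rdvd s Delta.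
  by rewrite -[ldvd s _]/((@ldvd M)^~ Delta s) (garside_divs (garside_elt hM)).
have [s [sP <-]] := garside_gen (garside_elt hM) m.
elim: s sP => [|a s IH] sP.
  by rewrite big_nil; split; exists 1; rewrite mulg1 mul1g.
rewrite big_cons; set p := \prod_(_ <- s) _.
have [b bP|[p' p'E] [p'' p''E]] := IH; first by apply: sP; rewrite inE bP orbT.
have da : ldvd a Delta by apply: sP; rewrite inE eqxx.
split.
  have [t tE] := da; have /dE[r rE] : rdvd t Delta by exists a.
  by exists (r * p'); rewrite -mulgA p'E mulgA {1}rE !mulgA -tE.
have /dE[t tE] := da; have /dE[r rE] : ldvd t Delta by exists a.
by exists (r * p''); rewrite -mulgA -p''E !mulgA [in RHS]tE mulgA -rE.
Qed.

(** The quotient of [u * D] and [v * D] is the conjugate of [u^-1 * v] by [D], and [Delta_normal]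
    says that this conjugation and its inverse preserve $M$. *)
Lemma right_order_autoD : right_order_auto D.
Proof.
move=> u v; rewrite /prec invgM; split=> -[m _ mE].
  have [_ [m' /(congr1 iota)]] := Delta_normal m.
  rewrite !gmulfM mE mulgA mulVKg mulgA => /mulIg e.
  by exists m'.
have [[m' m'E] _] := Delta_normal m.
move: m'E => /(congr1 iota); rewrite !gmulfM mE => e; exists m' => //.
by rewrite -[LHS](mulKg D) -e !mulgA.
Qed.
#[local] Hint Resolve right_order_autoD : core.

Lemma right_order_auto_expgz q : right_order_auto (expgz D q).
Proof. by case: q => n; [|apply: right_order_autoV]; apply: right_order_autoX. Qed.

(** * Intervals bounded by powers of [Delta] *)

Lemma prec1_iota m : 1 ≺ iota m.
Proof. by exists m => //; rewrite invg1 mul1g. Qed.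

Lemma prec_mulX k x y : x ≺ y -> x ≺ y * D ^+ k.
Proof.
by move=> xy; apply: trans xy _; exists (Delta ^+ k); rewrite ?mulKg ?gmulfXn.
Qed.

(** The exponent counts the factors in an expression of [m] by simple elements. *)
Lemma iota_prec_expD (m : M) : exists k, iota m ≺ D ^+ k.
Proof.
have [s [sP <-]] := garside_gen (garside_elt hM) m.
elim: s sP => [|a s IH] sP.
  by exists 0; rewrite big_nil gmulf1; apply: prec_refl.
have [b bP|k kP] := IH; first by apply: sP; rewrite inE bP orbT.
exists k.+1; rewrite big_cons gmulfM expgS.
apply: (@trans _ (iota a * D ^+ k)); first exact/prec_mul2l.
apply/(right_order_autoX _ k right_order_autoD)/(prec_iota hG).
by apply: sP; rewrite inE eqxx.
Qed.

Lemma prec_expD_bounds (v : G) : exists k, (D ^+ k)^-1 ≺ v /\ v ≺ D ^+ k.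
Proof.
have [a [b ->]] := hG.2 v.
have [k ak] := iota_prec_expD a; have [l bl] := iota_prec_expD b.
(* The lower bound only needs [k], which controls the denominator [a]; the upper one only needs [l],
   because $a^{-1} \prec 1$. *)
exists (k + l)%N; split.
  apply: (@trans _ (iota a)^-1).
    apply/(right_order_autoX _ (k + l) right_order_autoD).
    by apply/(prec_mul2l iota (iota a)); rewrite mulVg mulg1 mulVKg expgnDr;
       apply: prec_mulX.
  by apply/(prec_mul2l iota (iota a)); rewrite mulgV mulVKg; apply: prec1_iota.
apply/(prec_mul2l iota (iota a)); rewrite mulVKg.
apply: (@trans _ (D ^+ (k + l))).
  by rewrite addnC expgnDr; apply: prec_mulX.
rewrite -[X in X ≺ _]mul1g.
apply/(right_order_autoX _ (k + l) right_order_autoD); exact: prec1_iota.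
Qed.

Lemma finite_interval1 n : finite_set [set w | 1 ≺ w /\ w ≺ D ^+ n].
Proof.
elim: n => [|n IH].
  apply: sub_finite_set (finite_set1 1) => w /= [w1 w2].
  exact: anti.
have fin1 : finite_set [set w | 1 ≺ w /\ w ≺ D].
  apply: sub_finite_set (finite_image iota (garside_fin (garside_elt hM))).
  move=> w /= [[m _ mE]]; move: mE; rewrite invg1 mul1g => <-.
  by move=> /(prec_iota hG) dm; exists m.
apply: sub_finite_set (finite_image (fun p => p.1 * p.2) (finite_setX fin1 IH)).
(* Split off the greatest simple left divisor of [w]; what remains lies in the interval up to
   [D ^+ n]. *)
move=> w /= [w1 wn]; exists (w ∧ D, (w ∧ D)^-1 * w) => /=; last by rewrite mulVKg.
split=> /=; split.
- by apply: prec_meet => //; apply: prec1_iota.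
- exact: meet_precr.
- by apply/(prec_mul2l iota (w ∧ D)); rewrite mulg1 mulVKg; apply: meet_precl.
apply/(prec_mul2l iota (w ∧ D)); rewrite mulVKg.
(* The bound becomes the meet of [w * D ^+ n] and [D ^+ n.+1], both above [w]. *)
rewrite meetMr; last exact: right_order_autoX.
by rewrite -expgS; apply: prec_meet => //; apply/prec_mulX/prec_refl.
Qed.

Lemma finite_interval k : finite_set [set w | (D ^+ k)^-1 ≺ w /\ w ≺ D ^+ k].
Proof.
pose shift w := (D ^+ k)^-1 * w.
apply: sub_finite_set (finite_image shift (finite_interval1 (k + k))).
move=> w /= [w1 w2]; exists (D ^+ k * w); last by rewrite /shift mulKg.
split; first by rewrite -(mulgV (D ^+ k)); apply/prec_mul2l.
by rewrite expgnDr; apply/prec_mul2l.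
Qed.

(** * Transport of conjugators along cycling *)

Section Transport.
Variable q : int.
Local Notation z := (expgz D q).
Local Notation c := (cycling iota Delta q).
Let hz := right_order_auto_expgz q.

Definition transport x u := (x ∧ z)^-1 * ((x * u) ∧ (u * z)).

(** Read as a path from [c x] to [c (x ^ u)]: undo the cycling of [x], conjugate by [u], then cycle
    [x ^ u]. *)
Lemma transportE x u : transport x u = (x ∧ z)^-1 * u * (x ^ u ∧ z).
Proof. by rewrite -mulgA meetMl conjgE mulVKg. Qed.

Lemma cycling_conj x u : c (x ^ u) = c x ^ transport x u.
Proof. by rewrite transportE /cycling -!conjgM mulgA mulVKg. Qed.

(** Both [u] $\mapsto$ [x * u] and [u] $\mapsto$ [u * z] preserve meets, and [meetACA] regroups the
    four terms. *)
Lemma transport_meet x u v : transport x (u ∧ v) = transport x u ∧ transport x v.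
Proof. by rewrite /transport meetMl meetMr // meetACA meetMl. Qed.

(** The base point moves along the cycling orbit of [x]; only over a period of [x] does this become
    a self-map that can be iterated. *)
Fixpoint transport_iter n x u :=
  if n is n'.+1 then transport_iter n' (c x) (transport x u) else u.

Lemma iter_cycling_conj n x u :
  iter n c (x ^ u) = iter n c x ^ transport_iter n x u.
Proof. by elim: n x u => //= n IH x u; rewrite -!iterS !iterSr cycling_conj IH. Qed.

Lemma transport_iter_meet n x u v :
  transport_iter n x (u ∧ v) = transport_iter n x u ∧ transport_iter n x v.
Proof. by elim: n x u v => //= n IH x u v; rewrite transport_meet IH. Qed.

Lemma transport_iter1 n x : transport_iter n x 1 = 1.
Proof. by elim: n x => //= n IH x; rewrite transportE conjg1 mulg1 mulVg IH. Qed.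

Lemma transport_iterM n x u t : right_order_auto t -> commute t D ->
  transport_iter n x (u * t) = transport_iter n x u * t.
Proof.
move=> ht tD; elim: n x u => //= n IH x u.
rewrite -IH; congr transport_iter.
rewrite /transport -[RHS]mulgA meetMr // -!mulgA.
by congr (_ * (_ ∧ (u * _))); apply: commute_expgz.
Qed.

(** When [x ^ u = x ^ v], the last factor in [transportE] is the same for both and cancels; the
    equality of conjugates persists under cycling. *)
Lemma transport_iter_inj n x u v : x ^ u = x ^ v ->
  transport_iter n x u = transport_iter n x v -> u = v.
Proof.
elim: n x u v => //= n IH x u v xuv /IH e.
have : transport x u = transport x v by apply: e; rewrite -!cycling_conj xuv.
by rewrite !transportE xuv => /mulIg /mulgI.
Qed.

Lemma transport_iter_prec n x u v :
  u ≺ v -> transport_iter n x u ≺ transport_iter n x v.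
Proof. by move=> /meet_idPl e; apply/meet_idPl; rewrite -transport_iter_meet e. Qed.

Lemma transport_iter_of_auto n x t : right_order_auto t -> commute t D ->
  transport_iter n x t = t.
Proof. by move=> ht tD; rewrite -[t]mul1g transport_iterM // transport_iter1. Qed.

Lemma conjugator_periodic x v N :
  iter N c x = x -> iter N c (x ^ v) = x ^ v ->
  exists2 n, 0 < n & iter n (transport_iter N x) v = v.
Proof.
move=> xN yN; have [k [kv vk]] := prec_expD_bounds v.
have hk := right_order_autoX _ k right_order_autoD.
have ck : commute (D ^+ k) D by apply/commute_sym/commuteX/commute_refl.
(* The interval makes [A] finite; fixing the conjugate [x ^ w] makes the map injective on it. *)
pose A := [set w | (D ^+ k)^-1 ≺ w /\ w ≺ D ^+ k] `&` [set w | x ^ w = x ^ v].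
apply: (@finite_orbit_periodic _ _ A) => //.
- exact/finite_setIl/finite_interval.
- move=> w [[kw wk] /= wv]; split=> /=; last by rewrite -{1}xN -iter_cycling_conj wv.
  (* The endpoints are fixed by the map, so monotonicity keeps [w] between them. *)
  rewrite -{1}(@transport_iter_of_auto N x (D ^+ k)^-1); first last.
  + exact/commute_sym/commuteV/commute_sym.
  + exact: right_order_autoV.
  rewrite -{2}(@transport_iter_of_auto N x (D ^+ k)) //.
  by split; apply: transport_iter_prec.
- by move=> w w' [_ /= wv] [_ /= wv']; apply: transport_iter_inj; rewrite wv wv'.
Qed.

(** * Periodicity of conjugates *)

Lemma iter_period N n x : iter N c x = x -> iter (n * N) c x = x.
Proof. by move=> xN; elim: n => // n IH; rewrite mulSn iterD IH. Qed.

Lemma cycling_periodic_meet1 x v :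
  cycling_periodic iota Delta q x -> cycling_periodic iota Delta q (x ^ v) ->
  cycling_periodic iota Delta q (x ^ (1 ∧ v)).
Proof.
move=> [N1 N1_gt0 xN1] [N2 N2_gt0 yN2]; pose N := (N1 * N2)%N.
have xN : iter N c x = x by rewrite /N mulnC iter_period.
have yN : iter N c (x ^ v) = x ^ v by rewrite /N iter_period.
have [n n_gt0 vn] := conjugator_periodic x v N xN yN.
exists (n * N)%N; first by rewrite !muln_gt0 n_gt0 N1_gt0.
(* One period of [x] applies the composite transport once to the conjugator. *)
have iterE m w : iter (m * N) c (x ^ w) = x ^ iter m (transport_iter N x) w.
  elim: m w => // m IH w.
  by rewrite mulSnr iterD iter_cycling_conj xN IH iterSr.
rewrite iterE; congr (x ^ _); rewrite -[in RHS]vn.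
elim: n {n_gt0 vn iterE} => //= n ->.
by rewrite transport_iter_meet transport_iter1.
Qed.

Lemma cycling_periodic_meet x u v :
  cycling_periodic iota Delta q (x ^ u) ->
  cycling_periodic iota Delta q (x ^ v) ->
  cycling_periodic iota Delta q (x ^ (u ∧ v)).
Proof.
move=> xu xv; rewrite -{1}(mulg1 u) -{1}(mulVKg u v) -meetMl conjgM.
by apply: cycling_periodic_meet1; rewrite // -conjgM mulVKg.
Qed.

(** Transport fixes [t], so [x ^ t] inherits the period of [x]. *)
Lemma cycling_periodic_conj x t : right_order_auto t -> commute t D ->
  cycling_periodic iota Delta q x -> cycling_periodic iota Delta q (x ^ t).
Proof.
move=> ht tD [N N_gt0 xN]; exists N => //.
by rewrite iter_cycling_conj xN transport_iter_of_auto.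
Qed.

End Transport.
End GarsideGroup.

Theorem theorem3p3 (M : monoidType) (Delta : M) (G : groupType)
    (iota : UMagmaMorphism.type M G)
    (hM : garside_monoid Delta) (hG : group_of_fractions iota) :
  (forall (q : int) (x u v : G),
     cycling_periodic iota Delta q (x ^ u) ->
     cycling_periodic iota Delta q (x ^ v) ->
     cycling_periodic iota Delta q (x ^ meet iota u v)) /\
  (forall p q : int,
     cycling iota Delta q @` cycling_periodic iota Delta p `<=`
     cycling_periodic iota Delta p).
Proof.
split=> [q x u v|p q _ [x xp <-]]; first exact: cycling_periodic_meet.
(* Periodicity is for order [p], whereas the conjugator is the meet of [x] and the [q]-th power of
   [Delta]; moreover [x ^ x = x]. *)
apply: cycling_periodic_meet => //; first by rewrite conjgE mulKg.
apply: cycling_periodic_conj => //; first exact: right_order_auto_expgz.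
exact/commute_sym/commute_expgz/commute_refl.
Qed.
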